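(* Let $\alpha=(\alpha_1,\ldots,\alpha_s)$ be a composition (a finite sequence of positive integers) and suppose there is an index $t\in\{1,\ldots,s\}$ such that $$\alpha_t > \sum_{i\neq t}\alpha_i .$$ Then the lattice $L(\alpha)$ is rank unimodal; that is, if $n=\#F(\alpha)$ and $r_k(\alpha)$ denotes the number of order ideals of $F(\alpha)$ of cardinality $k$, the sequence $r_0(\alpha),r_1(\alpha),\ldots,r_n(\alpha)$ is unimodal.
   Context: For a composition $\alpha=(\alpha_1,\ldots,\alpha_s)$ of $n-1$ (positive integers with sum $n-1$), the fence poset $F(\alpha)$ has elements $x_1,\ldots,x_n$. For $1\le i\le s$ its $i$th segment is the set $\{x_j : \alpha_1+\cdots+\alpha_{i-1}+1\le j\le \alpha_1+\cdots+\alpha_i+1\}$. The covering relations are: consecutive elements of the $i$th segment satisfy $x_j\lhd x_{j+1}$ if $i$ is odd and $x_j\rhd x_{j+1}$ if $i$ is even (so the fence goes up along segment 1, down along segment 2, up along segment 3, and so on). Each segment is a chain, and $\#F(\alpha)=n$. $L(\alpha)$ is the distributive lattice of all lower order ideals of $F(\alpha)$ ordered by inclusion; it is ranked by cardinality of ideals. A sequence of nonnegative reals $a_0,\ldots,a_n$ is unimodal if there is an index $m$ with $a_0\le a_1\le\cdots\le a_m\ge a_{m+1}\ge\cdots\ge a_n$. *)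

(* Defs.v *)
From HB Require Import structures.
From mathcomp Require Import all_boot all_order.
From mathcomp Require Import zify.

Set Implicit Arguments.
Unset Strict Implicit.
Unset Printing Implicit Defensive.

Import Order.TTheory Order.DefaultSetSubsetOrder.

Definition composition (alpha : seq nat) : bool := all (leq 1) alpha.

(* The element x_j is the ordinal j - 1, and segments are numbered from 0, so
   that an even index denotes a segment along which the fence goes up. *)
Definition fence (alpha : seq nat) : Type := 'I_(sumn alpha).+1.

HB.instance Definition _ (alpha : seq nat) := Finite.on (fence alpha).
HB.instance Definition _ (alpha : seq nat) := SubType.on (fence alpha).

Definition segment (alpha : seq nat) (i : nat) : {set fence alpha} :=
  [set x | sumn (take i alpha) <= val x <= sumn (take i.+1 alpha)].

Definition fence_cover (alpha : seq nat) : rel (fence alpha) :=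
  fun x y => [exists i : 'I_(size alpha),
    [&& x \in segment alpha i, y \in segment alpha i &
        if odd i then val x == (val y).+1 else val y == (val x).+1]].

Definition fence_le (alpha : seq nat) : rel (fence alpha) :=
  connect (@fence_cover alpha).

Section FenceOrder.
Variable alpha : seq nat.
Implicit Types x y z : fence alpha.

Let psum i := sumn (take i alpha).

Let psum_mono i j : i <= j -> psum i <= psum j.
Proof.
move=> /subnKC <-; rewrite /psum takeD sumn_cat; exact: leq_addr.
Qed.

Let down k := [exists i : 'I_(size alpha),
  [&& odd i, psum i <= k & k.+1 <= psum i.+1]].

(* Each cover raises this height by one; the offset keeps it a natural number. *)
Let height k :=
  (sumn alpha).+1 + \sum_(l < k) ~~ down l - \sum_(l < k) down l.

Let height_step k : k <= sumn alpha ->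
  if down k then height k = (height k.+1).+1 else height k.+1 = (height k).+1.
Proof.
move=> lek; have : \sum_(l < k) down l <= k.
  rewrite -[leqRHS]card_ord -sum1_card; apply: leq_sum => i _.
  exact: leq_b1.
by rewrite /height !big_ord_recr /=; case: (down k) => /=; lia.
Qed.

Let cover_height x y : fence_cover x y -> height (val y) = (height (val x)).+1.
Proof.
have hx : val x <= sumn alpha by rewrite -ltnS; exact: ltn_ord.
have hy : val y <= sumn alpha by rewrite -ltnS; exact: ltn_ord.
case/existsP=> i; rewrite !inE => /and3P[/andP[xl xu] /andP[yl yu]].
case: ifPn => oi /eqP exy.
  have dy : down (val y).
    by apply/existsP; exists i; rewrite oi /psum yl -exy xu.
  by have := height_step hy; rewrite dy -exy.
have dx : ~~ down (val x).
  apply/negP => /existsP[j /and3P[oj jl ju]].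
  case: (ltngtP i j) => [ij|ji|eij].
  - have := leq_trans (psum_mono ij) jl.
    by move: yu; rewrite exy => yu; rewrite leqNgt yu.
  - have := leq_trans ju (psum_mono ji).
    by rewrite /psum ltnNge xl.
  - by rewrite eij oj in oi.
by have := height_step hx; rewrite (negbTE dx) -exy.
Qed.

Let le_height x y : fence_le x y -> x = y \/ height (val x) < height (val y).
Proof.
case/connectP=> p; elim: p x => [|z p IHp] x /=; first by left.
case/andP=> /cover_height hxz pzp yE; right.
by case: (IHp z pzp yE) => [<-|]; rewrite hxz // => /ltnW.
Qed.

Fact fence_le_refl : reflexive (@fence_le alpha).
Proof. exact: connect0. Qed.

Fact fence_le_anti : antisymmetric (@fence_le alpha).
Proof.
move=> x y /andP[/le_height[//|xy] /le_height[//|yx]].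
by have := ltn_trans xy yx; rewrite ltnn.
Qed.

Fact fence_le_trans : transitive (@fence_le alpha).
Proof. exact: connect_trans. Qed.

End FenceOrder.

Fact fence_display : Order.disp_t. Proof. exact: Order.Disp tt tt. Qed.

HB.instance Definition _ (alpha : seq nat) :=
  Order.Le_isPOrder.Build fence_display (fence alpha)
    (@fence_le_refl alpha) (@fence_le_anti alpha) (@fence_le_trans alpha).

Definition order_ideal d (T : finPOrderType d) : pred {set T} :=
  fun I => [forall x, forall y, (x <= y)%O && (y \in I) ==> (x \in I)].

Section OrderIdeals.
Variables (d : Order.disp_t) (T : finPOrderType d).

Lemma order_idealP (I : {set T}) :
  reflect (forall x y, (x <= y)%O -> y \in I -> x \in I) (order_ideal I).
Proof.
apply: (iffP 'forall_forallP) => [H x y xy yI|H x y].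
  by have /implyP := H x y; apply; rewrite xy.
by apply/implyP => /andP[xy]; apply: H.
Qed.

Definition ideal_of : Type := {I : {set T} | order_ideal I}.

HB.instance Definition _ := Finite.on ideal_of.
HB.instance Definition _ := SubType.on ideal_of.

Fact order_ideal_meet : meet_closed (@order_ideal d T : {pred {set T}}).
Proof.
move=> I J /order_idealP hI /order_idealP hJ; apply/order_idealP => x y xy.
by rewrite !inE => /andP[/(hI _ _ xy)-> /(hJ _ _ xy)->].
Qed.

Fact order_ideal_join : join_closed (@order_ideal d T : {pred {set T}}).
Proof.
move=> I J /order_idealP hI /order_idealP hJ; apply/order_idealP => x y xy.
by rewrite !inE => /orP[/(hI _ _ xy)->|/(hJ _ _ xy)->]; rewrite ?orbT.
Qed.

Fact order_ideal_bot : (\bot : {set T})%O \in @order_ideal d T.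
Proof. by apply/order_idealP => x y _; rewrite !inE. Qed.

Fact order_ideal_top : (\top : {set T})%O \in @order_ideal d T.
Proof. by apply/order_idealP => x y _; rewrite !inE. Qed.

HB.instance Definition _ :=
  @Order.SubChoice_isTBSubLattice.Build _ {set T}
    (@order_ideal d T) Order.SetSubsetOrder.subset_display ideal_of
    order_ideal_meet order_ideal_join order_ideal_bot order_ideal_top.

Fact ideal_meetUl : @left_distributive ideal_of ideal_of Order.meet Order.join.
Proof. move=> I J K; apply: val_inj; exact: meetUl. Qed.

HB.instance Definition _ :=
  Order.Lattice_Meet_isDistrLattice.Build Order.SetSubsetOrder.subset_display ideal_of
    ideal_meetUl.

End OrderIdeals.

Definition ideal_lattice (alpha : seq nat) : Type := ideal_of (fence alpha).

HB.instance Definition _ alpha :=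
  Order.FinTBDistrLattice.on (ideal_lattice alpha).
HB.instance Definition _ alpha := SubType.on (ideal_lattice alpha).

Definition rank_number (alpha : seq nat) (k : nat) : nat :=
  #|[set I : ideal_lattice alpha | #|(val I : {set fence alpha})| == k]|.

(* Only the terms a 0, ..., a n matter. *)
Definition unimodal (n : nat) (a : nat -> nat) : Prop :=
  exists2 m, m <= n &
    (forall k, k < m -> a k <= a k.+1) /\
    (forall k, m <= k < n -> a k.+1 <= a k).

Definition rank_unimodal (alpha : seq nat) : Prop :=
  unimodal #|{: fence alpha}| (rank_number alpha).

(* Main.v *)
(** The elements of the long segment form a chain c_0 < ... < c_L, where only
    c_0 can lie below an element outside the chain and only c_L can lie above
    one.  Since at most L - 1 elements lie outside the chain, an ideal of size
    less than L meets the chain in some c_0, ..., c_(h-1) with h < L, and adding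
    c_h keeps it an ideal; an ideal of size greater than L has h > 1, and
    removing c_(h-1) keeps it an ideal.  Both operations are injective, so the
    rank numbers increase up to L and decrease from there on. *)
Require Import Defs.
From mathcomp Require Import all_boot all_order.
From mathcomp Require Import zify.

Set Implicit Arguments.
Unset Strict Implicit.
Unset Printing Implicit Defensive.

(** * Transport of predicates along paths of a relation *)

Lemma connect_pred_l (T : finType) (e : rel T) (Q : T -> Prop) x y :
  (forall u v, e u v -> Q v -> Q u) -> connect e x y -> Q y -> Q x.
Proof.
move=> eQ /connectP[p]; elim: p x => [|z p IHp] x /=; first by move=> _ ->.
by case/andP=> exz pzp yE Qy; apply: (eQ _ z) => //; apply: IHp.
Qed.

Lemma connect_pred_r (T : finType) (e : rel T) (Q : T -> Prop) x y :
  (forall u v, e u v -> Q u -> Q v) -> connect e x y -> Q x -> Q y.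
Proof.
move=> eQ /connectP[p]; elim: p x => [|z p IHp] x /=; first by move=> _ ->.
by case/andP=> exz pzp yE Qx; apply: (IHp z) => //; apply: (eQ x).
Qed.

(** * Ideals of a finite poset with a long chain *)

Section LongChain.
Variables (d : Order.disp_t) (T : finPOrderType d) (L : nat) (c : nat -> T).
Hypothesis c_homo : forall i j, i <= j <= L -> (c i <= c j)%O.
Hypothesis c_inj : forall i j, i <= L -> j <= L -> c i = c j -> i = j.
Hypothesis c_lower : forall j x, j < L -> (x <= c j)%O ->
  exists2 i, i <= j & x = c i.
Hypothesis c_upper : forall j y, 0 < j <= L -> (c j <= y)%O ->
  exists2 i, j <= i <= L & y = c i.
Implicit Types I : {set T}.

Let C := [set c i | i : 'I_L.+1].

Let cardC : #|C| = L.+1.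
Proof.
rewrite card_imset ?card_ord // => i j /c_inj ij; apply: val_inj.
by apply: ij; rewrite -ltnS.
Qed.

(** For an ideal this is the index of the first chain element left out, or [L.+1] if there is
    none. *)
Definition chain_height I := #|I :&: C|.

(** An ideal meets a chain in an initial segment, which is determined by its cardinality. *)
Lemma mem_chain_height I i : order_ideal I -> i <= L ->
  (c i \in I) = (i < chain_height I).
Proof.
move=> /order_idealP idI leiL.
have cardc n : n <= L.+1 -> #|[set c j | j : 'I_n]| = n.
  move=> len; rewrite card_imset ?card_ord // => a b /c_inj ab.
  by apply/val_inj/ab; rewrite -ltnS (leq_trans (ltn_ord _)).
apply/idP/idP => [ciI | ].
  rewrite -[i.+1]cardc //; apply/subset_leq_card/subsetP => _ /imsetP[j _ ->].
  have leji : j <= i by rewrite -ltnS.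
  rewrite inE (idI _ (c i)) ?c_homo ?leji //=.
  by apply/imsetP; exists (inord j); rewrite // inordK // ltnS (leq_trans leji).
apply: contraLR => ciNI; rewrite -leqNgt -[leqRHS]cardc ?(leqW leiL) //.
apply/subset_leq_card/subsetP => x; rewrite inE => /andP[xI /imsetP[j _ xE]].
case: (ltnP j i) => [ltji | leij].
  by apply/imsetP; exists (Ordinal ltji).
by case/negP: ciNI; apply: idI xI; rewrite xE c_homo // leij -ltnS ltn_ord.
Qed.

Lemma chain_height_le I : chain_height I <= #|I|.
Proof. exact/subset_leq_card/subsetIl. Qed.

Lemma chain_height_leL I : chain_height I <= L.+1.
Proof. by rewrite -cardC; exact/subset_leq_card/subsetIr. Qed.

(** At most [#|T| - L.+1] elements of [I] lie off the chain. *)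
Lemma chain_height_ge I : #|I| + L.+1 <= chain_height I + #|T|.
Proof.
rewrite -(cardsC C) cardC -(cardsID C I) -addnA leq_add2l addnC leq_add2l.
by apply/subset_leq_card; rewrite setDE subsetIr.
Qed.

Definition chain_add I := c (chain_height I) |: I.
Definition chain_del I := I :\ c (chain_height I).-1.

Lemma memC i : i <= L -> c i \in C.
Proof. by move=> leiL; apply/imsetP; exists (inord i); rewrite ?inordK. Qed.

Section Add.
Variable I : {set T}.
Hypotheses (idI : order_ideal I) (hI : chain_height I < L).

Let topNI : c (chain_height I) \notin I.
Proof. by rewrite mem_chain_height ?ltnn // ltnW. Qed.

Lemma card_chain_add : #|chain_add I| = #|I|.+1.
Proof. by rewrite cardsU1 topNI. Qed.

(** As the height is below [L], [c_lower] puts everything under the new element on the chain, at a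
    smaller index and hence already in [I]. *)
Lemma chain_add_ideal : order_ideal (chain_add I).
Proof.
apply/order_idealP => x y xy; rewrite !inE => /orP[/eqP yE | yI].
  move: xy; rewrite yE => /(c_lower hI)[i]; rewrite leq_eqVlt => /orP[/eqP-> ->|].
    by rewrite eqxx.
  move=> ltih ->; rewrite mem_chain_height // ?ltih ?orbT //.
  exact/ltnW/(ltn_trans ltih).
by move/order_idealP: idI => /(_ _ _ xy yI) ->; rewrite orbT.
Qed.

Lemma chain_addK : chain_del (chain_add I) = I.
Proof.
rewrite /chain_del; have -> : chain_height (chain_add I) = (chain_height I).+1.
  rewrite {1}/chain_height /chain_add setIUl (setIidPl _) ?sub1set ?memC 1?ltnW //.
  by rewrite cardsU1 inE (negbTE topNI).
by rewrite setU1K.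
Qed.

End Add.

Section Del.
Variable I : {set T}.
Hypotheses (idI : order_ideal I) (hI : 1 < chain_height I).

Let lehL : (chain_height I).-1 <= L.
Proof. by have := chain_height_leL I; lia. Qed.

Let topI : c (chain_height I).-1 \in I.
Proof. by rewrite mem_chain_height // prednK // ltnW. Qed.

Lemma card_chain_del : #|I| = #|chain_del I|.+1.
Proof. by rewrite (cardsD1 (c (chain_height I).-1)) topI. Qed.

(** Nothing that stays lies above the removed element: its index is positive, so [c_upper] puts any
    such element on the chain, where the removed one was the highest in [I]. *)
Lemma chain_del_ideal : order_ideal (chain_del I).
Proof.
apply/order_idealP => x y xy; rewrite !inE => /andP[yNtop yI].
have /order_idealP/(_ _ _ xy yI) -> := idI; rewrite andbT.
apply: contraNneq yNtop => xE; move: xy; rewrite xE.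
have h0 : 0 < (chain_height I).-1 <= L by rewrite lehL; lia.
case/(c_upper h0) => i /andP[lehi leiL] yE; rewrite yE in yI *.
move: yI; rewrite mem_chain_height // => ltih.
by apply/eqP; congr c; lia.
Qed.

Lemma chain_delK : chain_add (chain_del I) = I.
Proof.
rewrite /chain_add; have -> : chain_height (chain_del I) = (chain_height I).-1.
  rewrite {1}/chain_height /chain_del setIDAC.
  rewrite {2}/chain_height (cardsD1 (c (chain_height I).-1) (I :&: C)).
  by rewrite inE topI memC.
by rewrite setD1K.
Qed.

End Del.

Lemma long_chain_unimodal : #|T| <= L.*2 ->
  unimodal #|T| (fun k => #|[set I : ideal_of T | #|val I| == k]|).
Proof.
move=> leTL; pose ideals k := [set I : {set T} | order_ideal I && (#|I| == k)].
(* Counting plain sets instead of subtype elements lets [chain_add] and [chain_del] act directly. *)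
have rankE k : #|[set I : ideal_of T | #|val I| == k]| = #|ideals k|.
  rewrite -(card_imset _ val_inj); apply: eq_card => I; rewrite [RHS]inE.
  apply/imsetP/andP => [[J] | [idI cI]].
    by rewrite inE => cJ ->; split=> //; exact: valP.
  by exists (Sub I idI); rewrite ?inE SubK.
exists L; first by rewrite ltnW // -cardC max_card.
split=> k kL; rewrite !rankE.
  have small I : I \in ideals k -> order_ideal I /\ chain_height I < L.
    rewrite inE => /andP[idI /eqP cI]; split=> //.
    by apply: leq_ltn_trans (chain_height_le I) _; rewrite cI.
  have addK : {in ideals k, cancel chain_add chain_del}.
    by move=> I /small[]; exact: chain_addK.
  rewrite -(card_in_imset (can_in_inj addK)).
  apply/subset_leq_card/subsetP => _ /imsetP[I Ik ->].
  have [idI hI] := small I Ik; rewrite inE chain_add_ideal //=.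
  by move: Ik; rewrite inE card_chain_add // eqSS => /andP[].
have large I : I \in ideals k.+1 -> order_ideal I /\ 1 < chain_height I.
  rewrite inE => /andP[idI /eqP cI]; split=> //.
  (* Here [#|I| >= L.+1] and [#|T| <= L.*2], so the height is at least 2(L + 1) - 2L = 2. *)
  by have := chain_height_ge I; rewrite cI; lia.
have delK : {in ideals k.+1, cancel chain_del chain_add}.
  by move=> I /large[]; exact: chain_delK.
rewrite -(card_in_imset (can_in_inj delK)).
apply/subset_leq_card/subsetP => _ /imsetP[I Ik ->].
have [idI hI] := large I Ik; rewrite inE chain_del_ideal //=.
by move: Ik; rewrite inE (card_chain_del idI) // eqSS => /andP[].
Qed.

End LongChain.

(** * A segment of the fence as a chain *)

Section FenceSegment.
Variable alpha : seq nat.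

Let psum i := sumn (take i alpha).

Lemma psumS i : i < size alpha -> psum i.+1 = psum i + nth 0 alpha i.
Proof. by move=> lti; rewrite /psum (take_nth 0) // sumn_rcons. Qed.

Lemma psum_le i j : i <= j -> psum i <= psum j.
Proof.
move=> /subnKC <-; rewrite /psum takeD sumn_cat; exact: leq_addr.
Qed.

Lemma psum_leq_sumn i : psum i <= sumn alpha.
Proof. by rewrite /psum -[in leqRHS](cat_take_drop i alpha) sumn_cat leq_addr. Qed.

Variable t : nat.
Hypothesis ltt : t < size alpha.

Let L := nth 0 alpha t.

(* Segment t listed from its bottom to its top. *)
Definition segment_chain (i : nat) : fence alpha :=
  inord (if odd t then psum t.+1 - i else psum t + i).

(** Positions up to [psum t.+1] are in range, so [inord] does not fall back on its default. *)
Lemma val_segment_chain i : i <= L ->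
  val (segment_chain i) = if odd t then psum t.+1 - i else psum t + i.
Proof.
move=> leiL; rewrite /segment_chain /= inordK // ltnS.
by have := psum_leq_sumn t.+1; rewrite psumS // -/L; case: ifP => _; lia.
Qed.

Lemma segment_chainP (x : fence alpha) : psum t <= val x <= psum t.+1 ->
  exists2 i, i <= L & x = segment_chain i.
Proof.
have := psumS ltt; rewrite -/L /= => pE xt.
pose i := if odd t then psum t.+1 - val x else val x - psum t.
have leiL : i <= L by rewrite /i /=; case: ifP; lia.
exists i => //; apply: val_inj; rewrite val_segment_chain // /i /=.
by case: (odd t); lia.
Qed.

Lemma segment_chain_inj i j : i <= L -> j <= L ->
  segment_chain i = segment_chain j -> i = j.
Proof.
move=> iL jL /(congr1 val); rewrite !val_segment_chain //.
by have := psumS ltt; rewrite -/L; case: ifP; lia.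
Qed.

Lemma segment_chain_homo i j : i <= j <= L ->
  (segment_chain i <= segment_chain j)%O.
Proof.
case/andP; elim: j => [|j IHj]; first by rewrite leqn0 => /eqP->.
rewrite leq_eqVlt ltnS => /orP[/eqP-> // | leij] ltjL.
apply: Order.POrderTheory.le_trans (IHj leij (ltnW ltjL)) _; apply: connect1.
apply/existsP; exists (Ordinal ltt); rewrite !inE -!/(psum _) /=.
have := psumS ltt; rewrite -/L => pE.
have := val_segment_chain ltjL; have := val_segment_chain (ltnW ltjL).
by rewrite /=; case: (odd t) => -> ->; lia.
Qed.

Hypothesis halpha : composition alpha.

(** Positivity of the parts makes segments that are not consecutive disjoint. *)
Lemma psum_lt i j : i < j -> i < size alpha -> psum i < psum j.
Proof.
move=> ltij ltia; apply: leq_trans (psum_le ltij).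
rewrite psumS // -[ltnLHS]addn0 ltn_add2l.
by have /allP/(_ _ (mem_nth 0 ltia)) := halpha.
Qed.

Definition segment_step (x y : nat) := if odd t then x == y.+1 else y == x.+1.

(* A cover with an end in segment t can leave the segment only downwards from
   its top or upwards from its bottom: consecutive segments have opposite
   directions, and every segment is nonempty. *)
Lemma fence_cover_segment (x y : fence alpha) : fence_cover x y ->
     (psum t <= val y <= psum t.+1)
       && (val y != psum (if odd t then t else t.+1))
  || (psum t <= val x <= psum t.+1)
       && (val x != psum (if odd t then t.+1 else t)) ->
  [/\ psum t <= val x <= psum t.+1, psum t <= val y <= psum t.+1
    & segment_step (val x) (val y)].
Proof.
case/existsP=> s; rewrite !inE -!/(psum _) /= => /and3P[xs ys dir].
have [ltst | ltts | est] := ltngtP s t.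
- have le1 := psum_le ltst.
  (* The preceding segment meets segment [t] only at [psum t], which is the upper end of the cover
     if [t] is odd and the lower end if [t] is even; both are excluded. The next segment is
     symmetric, at [psum t.+1]. *)
  have [/eqP<- | nst] := boolP (s.+1 == t).
    by move: dir xs ys; rewrite /=; case: (odd s) => /= /eqP; lia.
  have := @psum_lt s.+1 t; rewrite ltn_neqAle nst ltst => /(_ isT).
  by rewrite (leq_ltn_trans ltst ltt) => /(_ isT); case: (odd t); lia.
- have le1 := psum_le ltts.
  have [/eqP est | nst] := boolP (t.+1 == s :> nat).
    by move: dir xs ys; rewrite -est /=; case: (odd t) => /= /eqP; lia.
  have := @psum_lt t.+1 s; rewrite ltn_neqAle nst ltts => /(_ isT).
  by rewrite (leq_ltn_trans ltts (ltn_ord s)) => /(_ isT); case: (odd t); lia.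
- by move: dir xs ys; rewrite /segment_step est.
Qed.

(** Going down a path of covers, the index stays at most [j < L], hence off the top, the only exit
    downwards. *)
Lemma segment_chain_lower j x : j < L -> (x <= segment_chain j)%O ->
  exists2 i, i <= j & x = segment_chain i.
Proof.
move=> ltjL le_xj.
pose Q y := exists2 i, i <= j & y = segment_chain i.
apply: (@connect_pred_l _ (@fence_cover alpha) Q x (segment_chain j)) => //;
  last by exists j.
move=> u v uv [i leij vE].
have leiL : i <= L by lia.
have := psumS ltt; rewrite -/L => pE.
have vvE := val_segment_chain leiL; rewrite -vE in vvE.
have [|ut vt uv_step] := fence_cover_segment uv.
  by rewrite vvE; case: (odd t); lia.
have [k lekL uE] := segment_chainP ut; exists k => //.
have uuE := val_segment_chain lekL; rewrite -uE in uuE.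
by move: uv_step; rewrite /segment_step uuE vvE; case: (odd t) => /eqP; lia.
Qed.

(** Dually, going up keeps the index at least [j > 0], hence off the bottom. *)
Lemma segment_chain_upper j y : 0 < j <= L -> (segment_chain j <= y)%O ->
  exists2 i, j <= i <= L & y = segment_chain i.
Proof.
move=> /andP[j0 lejL] le_jy.
pose Q x := exists2 i, j <= i <= L & x = segment_chain i.
apply: (@connect_pred_r _ (@fence_cover alpha) Q (segment_chain j) y) => //;
  last by exists j; rewrite ?leqnn.
move=> u v uv [i /andP[leji leiL] uE].
have := psumS ltt; rewrite -/L => pE.
have uuE := val_segment_chain leiL; rewrite -uE in uuE.
have [|ut vt uv_step] := fence_cover_segment uv.
  by apply/orP; right; rewrite uuE; case: (odd t); lia.
have [k lekL vE] := segment_chainP vt; exists k => //.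
have vvE := val_segment_chain lekL; rewrite -vE in vvE.
by move: uv_step; rewrite lekL /segment_step uuE vvE; case: (odd t) => /eqP; lia.
Qed.

End FenceSegment.

Theorem theorem1p3 (alpha : seq nat) (halpha : composition alpha)
    (t : 'I_(size alpha))
    (ht : \sum_(i < size alpha | i != t) nth 0 alpha i < nth 0 alpha t) :
  rank_unimodal alpha.
Proof.
have ltt := ltn_ord t.
apply: (long_chain_unimodal (segment_chain_homo ltt) (segment_chain_inj ltt)
  (segment_chain_lower ltt halpha) (segment_chain_upper ltt halpha)).
(* The fence has one element more than the sum of the parts; strictness in [ht] absorbs this extra
   one. *)
rewrite card_ord sumnE (big_nth 0) big_mkord (bigD1 t) //= -addnn.
by rewrite -addnS leq_add2l.
Qed.
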